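(* Let $v$ be a smooth function on $S^{n-1}$ with $\int_{S^{n-1}}v\,d\mu=0$ and put $\mu_\varepsilon=(1+\varepsilon v)\mu$. Then the variation $$\delta_vK(\mu,\nu)=\lim_{\varepsilon\to0}\frac{K(\mu_\varepsilon,\nu)-K(\mu,\nu)}{\varepsilon}$$ satisfies $$\delta_vK(\mu,\nu)=-\int_{S^{n-1}}\log h\cdot v\,d\mu .$$
   Context: $S^{n-1}$ is the unit sphere in $\mathbb{R}^n$, $\sigma$ the uniform probability measure on it; $\nabla_{S^{n-1}}$ and $\nabla^2_{S^{n-1}}$ are the spherical gradient and Hessian; $D^2f=f\,\mathrm{Id}+\nabla^2_{S^{n-1}}f$ on tangent spaces. Cost: $c(x,y)=\log\frac1{\langle x,y\rangle}$ if $\langle x,y\rangle>0$, $c(x,y)=+\infty$ otherwise; $K(\mu,\nu)=\min_{\pi\in\Pi(\mu,\nu)}\int c\,d\pi$, where $\Pi(\mu,\nu)$ is the set of probability measures on $S^{n-1}\times S^{n-1}$ with marginals $\mu,\nu$. Standing setting: $\mu=e^{-V}\cdot\sigma$ and $\nu=e^{-W}\cdot\sigma$ are probability measures on $S^{n-1}$, and $$T(x)=\frac{h(x)\,x+\nabla_{S^{n-1}}h(x)}{\sqrt{h^2(x)+|\nabla_{S^{n-1}}h(x)|^2}}$$ is the optimal transportation mapping for the cost $c$ pushing forward $\mu$ onto $\nu$; here $h>0$ is the support function (restricted to $S^{n-1}$) of a compact convex body containing the origin in its interior. The densities of $\mu,\nu$, the function $h$ and the map $T$ are smooth, and $D^2h(x)>0$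 for all $x\in S^{n-1}$. For small $\varepsilon$, the Kantorovich potential corresponding to $(\mu_\varepsilon,\nu)$ has the form $h_\varepsilon=h+\varepsilon u+o(\varepsilon)$ for some smooth function $u$. *)

(* Defs.v *)
(* R^(n.+1) is 'rV[R]_n.+1, whose library norm is the sup norm, so the Euclidean
   structure is introduced explicitly. *)
From HB Require Import structures.
From mathcomp Require Import all_boot all_order all_algebra.
From mathcomp Require Import all_classical all_reals all_analysis.
Set Implicit Arguments.
Unset Strict Implicit.
Unset Printing Implicit Defensive.
Import Order.TTheory GRing.Theory Num.Theory.
Import numFieldNormedType.Exports.
Local Open Scope classical_set_scope.
Local Open Scope ring_scope.

Definition dot (R : realType) (m : nat) (u w : 'rV[R]_m) : R :=
  \sum_i u ord0 i * w ord0 i.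

Definition enorm (R : realType) (m : nat) (u : 'rV[R]_m) : R :=
  Num.sqrt (dot u u).

(* The unit sphere of R^(n.+1); the ambient dimension is written n.+1 only to
   make the sphere nonempty. *)
Record sphere (R : realType) (n : nat) := Sphere {
  pt : 'rV[R]_n.+1;
  enorm_pt : enorm pt == 1
}.

HB.instance Definition _ (R : realType) (n : nat) :=
  [isSub for @pt R n].
HB.instance Definition _ (R : realType) (n : nat) :=
  [Choice of sphere R n by <:].

Lemma enorm_delta (R : realType) (n : nat) :
  enorm (delta_mx ord0 ord0 : 'rV[R]_n.+1) == 1.
Proof.
rewrite /enorm /dot big_ord_recl big1 => [|i _]; rewrite !mxE /=.
  by rewrite mulr1 addr0 sqrtr1.
by rewrite mul0r.
Qed.

HB.instance Definition _ (R : realType) (n : nat) :=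
  isPointed.Build (sphere R n) (Sphere (enorm_delta R n)).
HB.instance Definition _ (R : realType) (n : nat) :=
  PointedTopological.copy (sphere R n) (initial_topology (@pt R n)).

Definition sphere_open (R : realType) (n : nat) : set (set (sphere R n)) :=
  open.

HB.instance Definition _ (R : realType) (n : nat) :=
  Measurable.copy (sphere R n) (g_sigma_algebraType (@sphere_open R n)).

Section calculus.
Variables (R : realType) (n : nat).
Implicit Types (f : sphere R n -> R) (x : sphere R n) (u w : 'rV[R]_n.+1).

(* y |-> f (y / |y|), with the irrelevant value 0 at the origin *)
Definition hext f (y : 'rV[R]_n.+1) : R :=
  oapp f 0 (insub ((enorm y)^-1 *: y)).

(* C^oo: all iterated directional derivatives of the 0-homogeneous extension
   exist and are differentiable away from the origin. *)
Definition smooth f : Prop :=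
  forall (ws : seq 'rV[R]_n.+1) (y : 'rV[R]_n.+1), y != 0 ->
    differentiable
      (foldr (fun w (g : 'rV[R]_n.+1 -> R) => fun z => 'D_w g z) (hext f) ws) y.

(* The Euclidean gradient of the 0-homogeneous extension is tangent to the
   sphere and equals the spherical gradient there. *)
Definition sgrad f x : 'rV[R]_n.+1 :=
  \row_i 'D_(delta_mx ord0 i) (hext f) (pt x).

Definition tangent x u : Prop := dot (pt x) u = 0.

(* Restricted to tangent vectors at x, the Euclidean Hessian of the
   0-homogeneous extension F is the Riemannian Hessian of the sphere: for any
   extension F the latter is D^2F(u,w) - <grad F, x> <u,w>, and here
   <grad F, x> = 0. *)
Definition shess f x u w : R := 'D_u (fun y => 'D_w (hext f) y) (pt x).

(* the quadratic form of D^2 f = f Id + Hess f *)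
Definition D2 f x u w : R := f x * dot u w + shess f x u w.

Definition D2_pos f : Prop :=
  forall x u, tangent x u -> u != 0 -> 0 < D2 f x u u.

Definition convex_body (Om : set 'rV[R]_n.+1) : Prop :=
  [/\ compact Om, convex_set Om & interior Om 0].

Definition is_support_function (Om : set 'rV[R]_n.+1) f : Prop :=
  forall x, f x = sup [set dot (pt x) z | z in Om].

End calculus.

Section transport.
Variables (R : realType) (n : nat).
Local Notation S := (sphere R n).
Local Open Scope ereal_scope.

Definition rotate (Q : 'M[R]_n.+1) (A : set S) : set S :=
  [set x : S | exists2 y, A y & pt x = (pt y *m Q)%R].

(* The uniform probability measure is the unique Borel probability measure on
   the sphere invariant under the orthogonal group. *)
Definition uniform_measure (sigma : probability S R) : Prop :=
  forall Q : 'M[R]_n.+1, (Q *m Q^T = 1%:M)%R ->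
  forall A : set S, measurable A -> sigma (rotate Q A) = sigma A.

Definition cost (x y : S) : \bar R :=
  if (0 < dot (pt x) (pt y))%R then (ln (dot (pt x) (pt y))^-1)%:E else +oo.

(* Set functions rather than measures as marginals: (1 + eps v) mu is a
   probability measure only for small eps. *)
Definition couplings (mu nu : set S -> \bar R) : set (probability (S * S)%type R) :=
  [set pi : probability (S * S)%type R | forall A : set S, measurable A ->
     pi (A `*` setT) = mu A /\ pi (setT `*` A) = nu A].

Definition transport_value (pi : probability (S * S)%type R) : \bar R :=
  \int[pi]_z cost z.1 z.2.

Definition K (mu nu : set S -> \bar R) : \bar R :=
  ereal_inf [set transport_value pi | pi in couplings mu nu].

Definition has_density (mu rho : set S -> \bar R) (g : S -> R) : Prop :=
  forall A : set S, measurable A -> mu A = \int[rho]_(x in A) (g x)%:E.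

Definition perturb (mu : probability S R) (v : S -> R) (eps : R) :
    set S -> \bar R :=
  fun A => \int[mu]_(x in A) (1 + eps * v x)%:E.

Definition optimal_map (mu nu : probability S R) (T : S -> S) : Prop :=
  [/\ measurable_fun setT T,
      forall A : set S, measurable A -> pushforward mu T A = nu A
    & \int[mu]_x cost x (T x) = K mu nu].

Definition c_transform (phi : S -> R) (y : S) : \bar R :=
  ereal_inf [set cost x y - (phi x)%:E | x in setT].

(* h is the potential when phi = - log h is a Kantorovich potential in the
   usual additive sense: phi (x) + phi^c (y) = c (x, y) almost everywhere for an
   optimal plan.  Here exp (phi^c (y)) = inf of h (x) / <x,y> over <x,y> > 0 is
   the radial function of the body whose support function is h. *)
Definition kantorovich_potential (mu nu : set S -> \bar R) (h : S -> R) : Prop :=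
  (exists2 Om, convex_body Om & is_support_function Om h) /\
  exists pi : probability (S * S)%type R,
    [/\ couplings mu nu pi,
        transport_value pi = K mu nu
      & {ae pi, forall z,
          cost z.1 z.2 =
            (- ln (h z.1))%:E + c_transform (fun x => - ln (h x))%R z.2}].

End transport.

(* Main.v *)
Require Import Defs.
From HB Require Import structures.
From mathcomp Require Import all_boot all_order all_algebra.
From mathcomp Require Import all_classical all_reals all_analysis.
From mathcomp Require Import measurable_realfun.
From mathcomp Require Import ring lra.
Set Implicit Arguments.
Unset Strict Implicit.
Unset Printing Implicit Defensive.
Import Order.TTheory GRing.Theory Num.Theory.
Import numFieldNormedType.Exports.
Local Open Scope classical_set_scope.
Local Open Scope ring_scope.

(** The proof uses Kantorovich duality twice, once from each side.

For a bounded measurable [phi] write [psi] for its c-transform.  Integrating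
[phi x + psi y <= c (x, y)] against a coupling gives, for a first marginal
[w mu],
[[
    D phi w := \int phi w dmu + \int psi dnu <= K (w mu, nu)    (weak_duality)
]]
with equality as soon as some coupling is carried by the contact set
[phi x + psi y = c (x, y)] ([complementary_slackness]).  The second term of
[D phi w] ignores [w], so [D phi (1 + eps v) = D phi 1 + eps \int phi v dmu].

Take [phi = - log h] and [phi_eps = - log h_eps].  Equality holds for [phi] at
[w = 1] and for [phi_eps] at [w = 1 + eps v]; testing each potential against
the other problem gives
[[
    eps \int phi v dmu <= K (mu_eps, nu) - K (mu, nu)
                       <= eps \int phi_eps v dmu.
]]
The expansion of [h_eps] bounds [h_eps - h] uniformly by a multiple of [eps];
as [h] is bounded away from [0], the same holds for [phi_eps - phi], and dividing
by [eps] squeezes the quotient ([K_quotient_estimate]).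

For [phi_eps] the contact property is the definition of a potential.  For
[phi] it has to be extracted from the formula for [T] ([cost_contact]): it says
that [h x x + grad h x], the point of the body at which [<x, .>] is maximal,
satisfies [<z, h x x + grad h x> <= h z] for every [z], with equality at [x].
This is [support_gradient]; it is obtained by comparing [h] to first order with
a maximiser of [<x, .>] in the body.  All bounds and measurability facts about
[log h] and its c-transform come from the body being compact with [0] in its
interior, and from [h] and the c-transform being respectively a supremum and an
infimum of functions whose strict super- and sublevel sets are open. *)

(** * The Euclidean inner product *)

Section dot_product.
Context {R : realType} {m : nat}.
Implicit Types u v w : 'rV[R]_m.

Lemma dotC u v : dot u v = dot v u.
Proof. by apply: eq_bigr => i _; rewrite mulrC. Qed.

Lemma dotDr u v w : dot u (v + w) = dot u v + dot u w.
Proof.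
by rewrite -big_split; apply: eq_bigr => i _; rewrite mxE mulrDr.
Qed.

Lemma dotZr a u v : dot u (a *: v) = a * dot u v.
Proof. by rewrite mulr_sumr; apply: eq_bigr => i _; rewrite mxE mulrCA. Qed.

Lemma dotDl u v w : dot (v + w) u = dot v u + dot w u.
Proof. by rewrite dotC dotDr !(dotC u). Qed.

Lemma dotZl a u v : dot (a *: v) u = a * dot v u.
Proof. by rewrite dotC dotZr dotC. Qed.

Lemma dot_ge0 u : 0 <= dot u u.
Proof. by apply: sumr_ge0 => i _; rewrite -expr2 sqr_ge0. Qed.

Lemma continuous_dot (X : topologicalType) (f g : X -> 'rV[R]_m) :
  continuous f -> continuous g -> continuous (fun x => dot (f x) (g x)).
Proof.
move=> cf cg; rewrite /dot.
apply: (continuous_big (U := R) (op := +%R)) => [z|i _ x].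
  exact: (@add_continuous R).
have cc (k : X -> 'rV[R]_m) :
    continuous k -> {for x, continuous (fun y => k y ord0 i)}.
  move=> ck.
  exact: (@continuous_comp _ _ _ k (fun M : 'rV[R]_m => M ord0 i) x (ck x)
    (@coord_continuous R 1 m ord0 i (k x))).
exact: (continuousM (cc _ cf) (cc _ cg)).
Qed.

Lemma enorm_gt0 u : (0 < enorm u) = (u != 0).
Proof.
rewrite /enorm sqrtr_gt0 lt_def dot_ge0 andbT; congr negb.
apply/eqP/eqP => [d0|->]; last first.
  by rewrite /dot big1 // => i _; rewrite mxE mul0r.
apply/rowP => i; rewrite mxE.
have /eqP : u ord0 i * u ord0 i = 0.
  apply: (psumr_eq0P _ d0) => // j _.
  by rewrite -expr2 sqr_ge0.
by rewrite mulf_eq0 orbb => /eqP.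
Qed.

Lemma sqr_enorm u : enorm u ^+ 2 = dot u u.
Proof. by rewrite sqr_sqrtr ?dot_ge0. Qed.

Lemma enormZ a u : enorm (a *: u) = `|a| * enorm u.
Proof.
by rewrite /enorm dotZl dotZr mulrA -expr2 sqrtrM ?sqr_ge0 // sqrtr_sqr.
Qed.

Lemma coord_le_norm u i : `|u ord0 i| <= `|u|.
Proof.
rewrite [leRHS]/Num.norm /= mx_normrE.
exact: (le_bigmax _ (fun x : 'I_1 * 'I_m => `|u x.1 x.2|) (ord0, i)).
Qed.

End dot_product.

(** * The sphere: compactness, Borel sets and homogeneous extensions *)

Section sphere_basics.
Context {R : realType} {n : nat}.
Local Notation S := (sphere R n).
Implicit Types x y : S.

Lemma dot_pt x : dot (pt x) (pt x) = 1.
Proof. by rewrite -sqr_enorm (eqP (enorm_pt x)) expr1n. Qed.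

Lemma dot_sphere_le1 x y : dot (pt x) (pt y) <= 1.
Proof.
have := dot_ge0 (pt x + (-1) *: pt y).
rewrite !(dotDl, dotDr, dotZl, dotZr) !dot_pt (dotC (pt y)); lra.
Qed.

Lemma coord_sphere_le1 x i : `|pt x ord0 i| <= 1.
Proof.
rewrite -(@ler_pXn2r _ 2) ?nnegrE // expr1n -(dot_pt x) /dot (bigD1 i) //=.
rewrite real_normK ?num_real // expr2 lerDl.
by apply: sumr_ge0 => j _; rewrite -expr2 sqr_ge0.
Qed.

Lemma pt_neq0 x : pt x != 0.
Proof. by rewrite -enorm_gt0 (eqP (enorm_pt x)). Qed.

Lemma pt_continuous : continuous (@pt R n).
Proof. exact: initial_continuous. Qed.

Lemma hext_pt (f : S -> R) x : hext f (pt x) = f x.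
Proof.
rewrite /hext (eqP (enorm_pt x)) invr1 scale1r.
by have -> : pt x = val x by []; rewrite valK.
Qed.

Lemma hextZ (f : S -> R) a u : 0 < a -> hext f (a *: u) = hext f u.
Proof.
move=> a0; rewrite /hext enormZ scalerA gtr0_norm // invfM mulrAC mulVf ?gt_eqF //.
by rewrite mul1r.
Qed.

Lemma unit_enorm {u : 'rV[R]_n.+1} : u != 0 -> enorm ((enorm u)^-1 *: u) == 1.
Proof.
move=> u0; rewrite enormZ gtr0_norm ?invr_gt0 ?enorm_gt0 // mulVf //.
by rewrite gt_eqF ?enorm_gt0.
Qed.

Lemma hextE (f : S -> R) u (u0 : u != 0) : hext f u = f (Sphere (unit_enorm u0)).
Proof.
rewrite /hext; case: insubP => [x _ e /=|]; last by rewrite unit_enorm.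
by congr f; apply: val_inj; rewrite e.
Qed.

Lemma open_sphere_measurable (A : set S) : open A -> measurable A.
Proof. by move=> oA; exact: sub_sigma_algebra. Qed.

Lemma continuous_sphere_measurable (f : S -> R) :
  continuous f -> measurable_fun setT f.
Proof.
move=> /continuousP cf; apply: (measurability _ (RGenOpens.measurableE R)).
move=> _ [_ [a [b ->] <-]]; rewrite setTI; apply: open_sphere_measurable.
exact/cf/interval_open.
Qed.

Lemma smooth_continuous (f : S -> R) : smooth f -> continuous f.
Proof.
move=> /(_ [::]) /= sf; have -> : f = hext f \o @pt R n.
  by apply/funext => x /=; rewrite hext_pt.
move=> x; apply: continuous_comp; first exact: pt_continuous.
by apply: differentiable_continuous; apply: sf; exact: pt_neq0.
Qed.

(** Used to bound smooth functions: they are restrictions of functions that are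
continuous on a neighbourhood of this compact set. *)
Lemma sphere_compact : compact (range (@pt R n)).
Proof.
apply: bounded_closed_compact.
  exists 1; split=> // M M1 _ [x _ <-].
  rewrite /= [leLHS]/Num.norm /= mx_normrE; apply: bigmax_le => [|[i j] _ /=].
    by rewrite ltW // (lt_trans _ M1).
  by rewrite (le_trans _ (ltW M1)) // (ord1 i) coord_sphere_le1.
have -> : range (@pt R n) = (fun u => dot u u) @^-1` [set 1].
  apply/seteqP; split=> [_ [x _ <-]|u /= du1]; first exact: dot_pt.
  have eu : enorm u == 1 by rewrite /enorm du1 sqrtr1.
  by exists (Sphere eu).
apply: preimage_closed; last exact: closed_eq.
by move=> u _; apply: continuous_dot => ?; exact: cvg_id.
Qed.

Lemma smooth_bounded (f : S -> R) : smooth f ->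
  exists2 M : R, 0 < M & forall x, `|f x| <= M.
Proof.
move=> /(_ [::]) /= sf.
have : bounded_set (hext f @` range (@pt R n)).
  apply: compact_bounded; apply: continuous_compact; last exact: sphere_compact.
  apply: continuous_in_subspaceT => _ /set_mem [x _ <-].
  by apply: differentiable_continuous; apply: sf; exact: pt_neq0.
move=> /ex_strict_bound_gt0 [M M0 fM]; exists M => // x; rewrite -hext_pt ltW //.
by apply: fM; exists (pt x) => //; exists x.
Qed.

End sphere_basics.
(** * Support functions of convex bodies *)

Section support_function.
Context {R : realType} {n : nat}.
Context {Om : set 'rV[R]_n.+1} {h : sphere R n -> R}.
Hypotheses (Om_body : convex_body Om) (h_support : is_support_function Om h).
Local Notation S := (sphere R n).
Implicit Types x y : S.

Let Om0 : Om 0.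
Proof. by case: Om_body => _ _ /interior_subset. Qed.

Let dot_pt_continuous x : continuous (dot (pt x)).
Proof.
apply: (continuous_dot (f := fun=> pt x) (g := id)) .
- exact: cst_continuous.
- by move=> u; exact: cvg_id.
Qed.

(** The supremum defining a support function is a maximum because the body is
compact; the point [p] where it is reached later turns out to be
[h x x + grad h x]. *)
Lemma support_attained x :
  exists2 p, Om p & (dot (pt x) p = h x /\ forall z, Om z -> dot (pt x) z <= h x).
Proof.
case: Om_body => cOm _ _.
have [||p pOm pmax] := @compact_EVT_max _ _ (dot (pt x)) Om _ cOm.
- by exists 0.
- by apply: continuous_subspaceT; exact: dot_pt_continuous.
exists p; first by rewrite -inE.
have max z : Om z -> dot (pt x) z <= dot (pt x) p.
  by move=> Oz; apply: pmax; rewrite inE.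
suff -> : h x = dot (pt x) p by [].
apply/eqP; rewrite h_support eq_le; apply/andP; split.
  apply: ge_sup; first by exists (dot (pt x) 0); exists 0.
  by move=> _ [z Oz <-]; exact: max.
apply: ub_le_sup; last by exists p => //; rewrite -inE.
by exists (dot (pt x) p) => _ [z Oz <-]; exact: max.
Qed.

Lemma support_ub x z : Om z -> dot (pt x) z <= h x.
Proof. by have [p _ [_]] := support_attained x; apply. Qed.

(** The body contains a ball around [0], hence a small multiple of [x]. *)
Lemma support_lower_bound : exists2 r : R, 0 < r & forall x, r <= h x.
Proof.
case: Om_body => _ _ /nbhs_ballP [r /= r0 rOm].
exists (r / 2); first by rewrite divr_gt0.
move=> x.
have -> : r / 2 = dot (pt x) ((r / 2) *: pt x) by rewrite dotZr dot_pt mulr1.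
apply: support_ub.
apply: rOm; rewrite -ball_normE /= add0r normrN normrZ gtr0_norm ?divr_gt0 //.
have : `|pt x| <= 1.
  rewrite [leLHS]/Num.norm /= mx_normrE; apply: bigmax_le => // -[i j] _ /=.
  by rewrite (ord1 i) coord_sphere_le1.
move=> x1; rewrite (le_lt_trans (ler_piMr _ x1)) ?divr_ge0 ?(ltW r0) //; lra.
Qed.

Lemma support_upper_bound : exists M : R, forall x, h x <= M.
Proof.
case: Om_body => /compact_bounded /ex_strict_bound_gt0 [M M0 OmM] _ _.
exists (\sum_(i < n.+1) M) => x; have [p Op [<- _]] := support_attained x.
apply: ler_sum => i _; rewrite (le_trans (ler_norm _)) // normrM.
rewrite -[M]mul1r ler_pM // ?coord_sphere_le1 //.
by rewrite (le_trans (coord_le_norm p i)) // ltW //; exact: OmM.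
Qed.

(** Being a supremum of continuous functions, [h] has open superlevel sets; this
avoids proving that it is Lipschitz. *)
Lemma support_measurable : measurable_fun setT h.
Proof.
apply: (measurability _ (RGenOInfty.measurableE R)).
move=> _ [_ [a ->] <-]; rewrite setTI; apply: open_sphere_measurable.
have -> : h @^-1` `]a, +oo[ =
    \bigcup_(z in Om) ((fun x => dot (pt x) z) @^-1` `]a, +oo[).
  apply/seteqP; split=> x /=.
    rewrite in_itv /= andbT => ah; have [p Op [pe _]] := support_attained x.
    by exists p => //=; rewrite in_itv /= andbT pe.
  move=> [z Oz] /=; rewrite !in_itv /= !andbT => /lt_le_trans; apply.
  exact: support_ub.
apply: bigcup_open => z Oz; apply: open_comp; last exact: interval_open.
move=> x _; apply: (continuous_dot (f := @pt R n) (g := fun=> z)).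
  exact: pt_continuous.
exact: cst_continuous.
Qed.

Hypothesis (h_pos : forall x, 0 < h x).
Hypothesis (h_diff : forall u, u != 0 -> differentiable (hext h) u).

Lemma derive_hext x w : 'D_w (hext h) (pt x) = dot w (sgrad h x).
Proof.
have dh := h_diff (pt_neq0 x).
rewrite deriveE // {1}(row_sum_delta w) linear_sum /=.
by apply: eq_bigr => i _; rewrite linearZ /= mxE deriveE.
Qed.

(** The extension is constant along rays, so its derivative in the radial
direction vanishes. *)
Lemma sgrad_tangent x : dot (pt x) (sgrad h x) = 0.
Proof.
rewrite -derive_hext /derive.
apply/cvg_lim => //; apply: (@cvg_trans _ ((fun=> 0 : R) @ 0^')); last exact: cvg_cst.
apply: near_eq_cvg; exists 1 => //= t; rewrite /ball_ /= add0r normrN => t1 _.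
have t0 : 0 < t + 1 by have := ler_norm (- t); rewrite normrN; lra.
by rewrite -{2}[pt x]scale1r -scalerDl hextZ // subrr scaler0.
Qed.

(** The function [<., p>] lies below [h] and touches it at [x], so the two agree
to first order there.  Along [t |-> x + t w] with [w] tangent, the norm is at
most its square [1 + t ^ 2 |w| ^ 2], which has zero derivative at [0]: using the
square keeps the comparison function [G] differentiable without differentiating
the norm. *)
Lemma support_point x p : Om p -> dot (pt x) p = h x ->
  forall w, dot (pt x) w = 0 -> dot w p = dot w (sgrad h x).
Proof.
move=> Op pe w xw.
pose c := dot w w.
pose G (t : R) :=
  (1 + t ^+ 2 * c) * hext h (t *: w + pt x) - dot (t *: w + pt x) p.
(* the line stays at distance at least 1 from the origin *)
have nz t : t *: w + pt x != 0.
  apply/eqP => /(congr1 (dot (pt x))).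
  rewrite dotDr dotZr xw mulr0 add0r dot_pt => /eqP.
  by rewrite /dot big1 ?oner_eq0 // => i _; rewrite mxE mulr0.
have dF (t : R) : derivable (fun t : R => hext h (t *: w + pt x)) t 1.
  apply: diff_derivable.
  apply: (@differentiable_comp _ _ _ _ (fun t : R => t *: w + pt x) (hext h)).
    by [].
  exact: h_diff.
have dF0 : is_derive (0 : R) 1 (fun t : R => hext h (t *: w + pt x))
    (dot w (sgrad h x)).
  apply: DeriveDef; first exact: dF.
  rewrite -derive_hext /derive.
  apply: (congr1 (fun k : R -> R => lim (k @ 0^'))); apply/funext => t /=.
  by rewrite addr0 scale0r add0r [t *: 1]mulr1.
have dQ (t : R) : is_derive t 1 (fun t : R => 1 + t ^+ 2 * c) (2 * t * c).
  rewrite (_ : (fun _ => _) = cst 1 + id * id * cst c).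
    apply: (is_derive_eq (is_deriveD (is_derive_cst (1 : R) t 1)
      (is_deriveM (is_deriveM (is_derive_id t (1 : R)) (is_derive_id t 1))
        (is_derive_cst c t 1)))).
    rewrite scaler0 !add0r /GRing.scale /=; ring.
  by apply/funext => s; rewrite expr2.
have dL (t : R) : is_derive t 1 (fun t : R => dot (t *: w + pt x) p) (dot w p).
  rewrite (_ : (fun _ => _) = id * cst (dot w p) + cst (dot (pt x) p)).
    by apply: is_derive_eq; rewrite /GRing.scale /=; ring.
  by apply/funext => s; rewrite dotDl dotZl.
have dG t : derivable G t 1.
  by apply: derivableB => //; apply: derivableM.
have dG0 := is_deriveB (is_deriveM (dQ 0) dF0) (dL 0).
have G0 : G 0 = 0.
  by rewrite /G scale0r add0r expr0n mul0r addr0 mul1r hext_pt pe subrr.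
have Gge0 t : 0 <= G t.
  rewrite subr_ge0 (hextE _ (nz t)).
  set y := t *: w + pt x; set z := Sphere _.
  have -> : y = enorm y *: pt z.
    by rewrite /z /= scalerA mulfV ?scale1r // gt_eqF // enorm_gt0 nz.
  rewrite dotZl; apply: (@le_trans _ _ (enorm y * h z)).
    by rewrite ler_wpM2l ?sqrtr_ge0 // support_ub.
  rewrite ler_wpM2r ?(ltW (h_pos _)) //.
  have e2 : enorm y ^+ 2 = 1 + t ^+ 2 * c.
    rewrite sqr_enorm /y !(dotDl, dotDr, dotZl, dotZr) dot_pt (dotC w) xw /c; ring.
  have e1 : 1 <= enorm y.
    rewrite -(@ler_pXn2r _ 2) ?nnegrE ?sqrtr_ge0 // expr1n e2 lerDl.
    by rewrite mulr_ge0 ?sqr_ge0 ?dot_ge0.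
  by rewrite -e2 expr2 ler_peMl // (le_trans ler01).
have dGmin : is_derive (0 : R) 1 G 0.
  apply: (@derive1_at_min _ G (-1) 1) => [|t _||t _].
  - lra.
  - exact: dG.
  - by rewrite in_itv /= ltrN10 ltr01.
  - by rewrite G0.
have := @derive_val _ _ _ _ _ _ _ dGmin.
rewrite (@derive_val _ _ _ _ _ _ _ dG0) expr0n mul0r addr0 scale1r mulr0 mul0r.
by rewrite scaler0 addr0 => /eqP; rewrite subr_eq0 => /eqP.
Qed.

(** Since [p] and [h x x + grad h x] have the same inner product with [x] and with
all tangent vectors they coincide, and [p] belongs to the body. *)
Lemma support_gradient x z : dot (pt z) (h x *: pt x + sgrad h x) <= h z.
Proof.
have [p Op [pe _]] := support_attained x.
suff <- : dot (pt z) p = dot (pt z) (h x *: pt x + sgrad h x) by exact: support_ub.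
pose a := dot (pt x) (pt z); pose w := pt z + (- a) *: pt x.
have -> : pt z = w + a *: pt x by rewrite /w -addrA -scalerDl addNr scale0r addr0.
have xw : dot (pt x) w = 0 by rewrite dotDr dotZr dot_pt mulr1 subrr.
rewrite 2!dotDl !dotDr !dotZl !dotZr (support_point Op pe xw) pe dot_pt.
by rewrite sgrad_tangent (dotC w (pt x)) xw; ring.
Qed.

End support_function.
(** * The cost and its transform *)

Section cost_transform.
Context {R : realType} {n : nat}.
Local Notation S := (sphere R n).
Implicit Types x y : S.
Local Open Scope ereal_scope.

Lemma cost_ge0 x y : 0 <= cost x y.
Proof.
rewrite /cost; case: ifPn => // d0; rewrite lee_fin ln_ge0 //.
by rewrite invf_ge1 // dot_sphere_le1.
Qed.

Lemma costxx x : cost x x = 0.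
Proof. by rewrite /cost dot_pt ltr01 invr1 ln1. Qed.

(** Strict sublevel sets of the cost are spherical caps, whatever the sign of the
inner product; in particular they are open. *)
Lemma cost_lt x y (b : R) : (cost x y < b%:E) = (expR (- b) < dot (pt x) (pt y))%R.
Proof.
rewrite /cost; case: ifPn => d0.
  rewrite lte_fin lnV ?posrE // ltrNl.
  by rewrite -[X in _ = (_ < X)%R]lnK ?posrE // ltr_expR.
rewrite ltNge leey /=; apply/esym/negbTE; rewrite -leNgt.
by rewrite (le_trans _ (expR_ge0 _)) // leNgt.
Qed.

Lemma measurable_cost : measurable_fun setT (fun z : S * S => cost z.1 z.2).
Proof.
have mpt i : measurable_fun setT (fun x : S => pt x ord0 i).
  apply: continuous_sphere_measurable => x.
  exact: (@continuous_comp _ _ _ (@pt R n) (fun M : 'rV[R]_n.+1 => M ord0 i) x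
    (@pt_continuous _ _ x) (@coord_continuous R 1 n.+1 ord0 i (pt x))).
have mdot : measurable_fun setT (fun z : S * S => dot (pt z.1) (pt z.2)).
  apply: measurable_sum => i; apply: measurable_funM.
    by apply: (measurableT_comp (mpt i)); exact: measurable_fst.
  by apply: (measurableT_comp (mpt i)); exact: measurable_snd.
rewrite (_ : (fun z => _) = fun z : S * S => if (0 < dot (pt z.1) (pt z.2))%R
    then (- ln (dot (pt z.1) (pt z.2)))%:E else +oo); last first.
  by apply/funext => z; rewrite /cost; case: ifPn => // d0; rewrite lnV ?posrE.
apply: measurable_fun_ifT => //; first exact: measurable_fun_ltr.
apply/measurable_EFinP; apply: measurableT_comp => //.
by apply: (measurableT_comp (@measurable_ln R)).
Qed.

Context {phi : S -> R}.

Lemma c_transform_le x y : c_transform phi y <= cost x y - (phi x)%:E.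
Proof. by apply: ereal_inf_lbound; exists x. Qed.

(** An infimum of functions with open strict sublevel sets inherits that
property, although the infimum is over an uncountable family. *)
Lemma measurable_c_transform : measurable_fun setT (c_transform phi).
Proof.
apply: (measurability _ (ErealGenInftyO.measurableE R)).
move=> _ [_ [a ->] <-]; rewrite setTI; apply: open_sphere_measurable.
have -> : c_transform phi @^-1` `]-oo, a%:E[ =
    \bigcup_(x in setT)
      ((fun y => dot (pt x) (pt y)) @^-1` `]expR (- (a + phi x))%R, +oo[).
  apply/seteqP; split=> y /=.
    rewrite in_itv /= => /ereal_inf_lt [_ [x _ <-]].
    rewrite lteBlDr // -EFinD cost_lt => xy.
    by exists x => //=; rewrite in_itv /= xy.
  move=> [x _] /=; rewrite !in_itv /= andbT -cost_lt EFinD -lteBlDr //.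
  by apply: le_lt_trans; exact: c_transform_le.
apply: bigcup_open => x _; apply: open_comp; last exact: interval_open.
move=> y _; apply: (continuous_dot (f := fun=> pt x) (g := @pt R n)).
  exact: cst_continuous.
exact: pt_continuous.
Qed.

(** The lower bound uses that the cost is nonnegative, the upper bound that the
cost vanishes on the diagonal. *)
Lemma c_transform_bounds (m M : R) :
  (forall x, (m <= phi x <= M)%R) ->
  forall y, (- M)%:E <= c_transform phi y <= (- m)%:E.
Proof.
move=> mM y; apply/andP; split.
  apply/ereal_infP => _ [x _ <-]; have /andP[_ pM] := mM x.
  rewrite -[leLHS]add0e; apply: leeD; first exact: cost_ge0.
  by rewrite lee_fin lerN2.
apply: (le_trans (c_transform_le y y)); rewrite costxx add0e lee_fin lerN2.
by have /andP[] := mM y.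
Qed.

End cost_transform.

(** With [s] the norm of [h x x + grad h x], the c-transform of [- log h] at [T x]
is [log s]: no [z] does better because [<z, T x> <= h z / s], and [z = x] gives
equality. *)
Lemma cost_contact {R : realType} {n : nat} {Om : set 'rV[R]_n.+1}
    {h : sphere R n -> R} {T : sphere R n -> sphere R n} :
  convex_body Om -> is_support_function Om h -> (forall x, 0 < h x) ->
  (forall u, u != 0 -> differentiable (hext h) u) ->
  (forall x, pt (T x) = (Num.sqrt (h x ^+ 2 + enorm (sgrad h x) ^+ 2))^-1
       *: (h x *: pt x + sgrad h x)) ->
  forall x, cost x (T x) =
    ((- ln (h x))%:E + c_transform (fun z => - ln (h z))%R (T x))%E.
Proof.
move=> Omb hs h0 dh TE x.
pose s := Num.sqrt (h x ^+ 2 + enorm (sgrad h x) ^+ 2).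
have s0 : 0 < s by rewrite sqrtr_gt0 ltr_pwDl ?exprn_gt0 ?sqr_ge0.
have zT z : dot (pt z) (pt (T x)) <= s^-1 * h z.
  rewrite TE -/s dotZr ler_pM2l ?invr_gt0 //.
  exact: (support_gradient Omb hs h0 dh).
have xT : dot (pt x) (pt (T x)) = s^-1 * h x.
  by rewrite TE -/s dotZr dotDr dotZr dot_pt mulr1 (sgrad_tangent dh) addr0.
have costxT : cost x (T x) = (ln s - ln (h x))%:E.
  rewrite /cost xT pmulr_rgt0 ?invr_gt0 // h0.
  by rewrite invfM invrK lnM ?posrE ?invr_gt0 // lnV ?posrE.
suff -> : c_transform (fun z => - ln (h z)) (T x) = (ln s)%:E.
  by rewrite costxT addrC EFinD.
apply/eqP; rewrite eq_le; apply/andP; split.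
  apply: (le_trans (c_transform_le x (T x))).
  by rewrite costxT -EFinB opprK subrK.
apply/ereal_infP => _ [z _ <-]; rewrite -EFinN opprK /cost.
case: ifPn => [d0|_]; last by rewrite addye ?leey.
rewrite -EFinD lee_fin lnV ?posrE // addrC lerBrDl -lnM ?posrE //.
by rewrite ler_ln ?posrE ?mulr_gt0 // mulrC -ler_pdivlMl.
Qed.
(** * Changing the marginals of an integral *)

Lemma bounded_integrable {d} {X : measurableType d} {R : realType}
    (m : probability X R) (f : X -> R) (M : R) :
  measurable_fun setT f -> (forall x, `|f x| <= M) ->
  m.-integrable setT (EFin \o f).
Proof.
move=> mf fM; apply: measurable_bounded_integrable => //.
  by rewrite (@le_lt_trans _ _ 1%E) ?ltry ?probability_le1 ?measurableT.
by exists M; split=> [|N MN x _]; [exact: num_real|exact: le_trans (ltW MN)].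
Qed.

(** Both [w] and the Radon-Nikodym derivative of [m] have integral [m A] over
every measurable [A], so they agree almost everywhere and the change of variables
for the derivative applies to [w]. *)
Lemma integral_density {d} {X : measurableType d} {R : realType}
    (m mu : probability X R) (w f : X -> R) :
  mu.-integrable setT (EFin \o w) ->
  (forall A, measurable A -> m A = \int[mu]_(x in A) (w x)%:E)%E ->
  m.-integrable setT (EFin \o f) ->
  (\int[m]_x (f x)%:E = \int[mu]_x (f x * w x)%:E)%E.
Proof.
move=> iw mw if_; have mfw := measurable_int _ iw; have mff := measurable_int _ if_.
have dom : m `<< mu.
  move=> N N0 A mA AN; rewrite mw //; apply: null_set_integral => //.
    exact: measurable_funTS.
  exact: N0.
have cdom : charge_of_finite_measure m `<< mu by [].
rewrite -(Radon_Nikodym_change_of_variables dom) //.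
under [RHS]eq_integral do rewrite EFinM.
apply: ae_eq_integral => //.
- exact: (emeasurable_funM mff (measurable_int _ (Radon_Nikodym_integrable cdom))).
- exact: (emeasurable_funM mff mfw).
- apply: ae_eqe_mul2l; apply: integral_ae_eq => //.
    exact: Radon_Nikodym_integrable.
  by move=> E _ mE; rewrite -Radon_Nikodym_integral //= -mw.
Qed.

Section coupling_integrals.
Context {R : realType} {n : nat}.
Local Notation S := (sphere R n).
Context {rho : set S -> \bar R} {mu nu : probability S R}.
Context {w phi psi : S -> R} {B : R}.
Hypotheses (mw : measurable_fun setT w) (wB : forall x, `|w x| <= B).
Hypotheses (mphi : measurable_fun setT phi) (phiB : forall x, `|phi x| <= B).
Hypotheses (mpsi : measurable_fun setT psi) (psiB : forall x, `|psi x| <= B).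
Hypothesis rho_density : has_density rho mu w.
Context {ga : probability (S * S)%type R}.
Hypothesis ga_coupling : couplings rho nu ga.
Local Open Scope ereal_scope.

Let mfst : {mfun (S * S)%type >-> S} :=
  HB.pack (@fst S S) (isMeasurableFun.Build _ _ _ _ _ measurable_fst).

Let msnd : {mfun (S * S)%type >-> S} :=
  HB.pack (@snd S S) (isMeasurableFun.Build _ _ _ _ _ measurable_snd).

Let i1 : ga.-integrable setT (EFin \o (phi \o fst)).
Proof.
apply: (@bounded_integrable _ _ _ _ _ B) => [|z]; last exact: phiB.
by apply: (measurableT_comp mphi); exact: measurable_fst.
Qed.

Let i2 : ga.-integrable setT (EFin \o (psi \o snd)).
Proof.
apply: (@bounded_integrable _ _ _ _ _ B) => [|z]; last exact: psiB.
by apply: (measurableT_comp mpsi); exact: measurable_snd.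
Qed.

Lemma coupling_integrable : ga.-integrable setT (fun z => (phi z.1 + psi z.2)%:E).
Proof.
under eq_fun do rewrite EFinD.
exact: integrableD.
Qed.

Lemma coupling_integral :
  \int[ga]_z (phi z.1 + psi z.2)%:E =
  \int[mu]_x (phi x * w x)%:E + \int[nu]_y (psi y)%:E.
Proof.
under eq_integral do rewrite EFinD.
rewrite integralD //; congr (_ + _).
  pose m := distribution ga mfst.
  rewrite -(@integral_density _ _ _ m) //.
  - by rewrite integral_distribution //; exact/measurable_EFinP.
  - exact: (@bounded_integrable _ _ _ _ _ B).
  - move=> A mA; rewrite -rho_density // -(ga_coupling mA).1.
    by rewrite /m /distribution /pushforward; congr (ga _);
      apply/seteqP; split=> z //= [].
  - exact: (@bounded_integrable _ _ _ _ _ B).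
transitivity (\int[distribution ga msnd]_y (psi y)%:E).
  by rewrite integral_distribution //; exact/measurable_EFinP.
apply: eq_measure_integral => A mA _; apply: etrans (ga_coupling mA).2.
by rewrite /distribution /pushforward; congr (ga _);
  apply/seteqP; split=> z //= [].
Qed.

End coupling_integrals.
(** * Weak duality and complementary slackness *)

Lemma EFin_Rintegral {d} {X : measurableType d} {R : realType}
    (m : probability X R) (f : X -> R) :
  m.-integrable setT (EFin \o f) ->
  (\int[m]_x (f x)%:E)%E = (\int[m]_x f x)%:E.
Proof. by move=> fi; rewrite /Rintegral fineK //; exact: integrable_fin_num. Qed.

(** The c-transform as a real function; [fine] loses nothing for a bounded [f],
by [dual_potentialE]. *)
Definition dual_potential {R : realType} {n : nat} (f : sphere R n -> R)
    (y : sphere R n) : R := fine (c_transform f y).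

(** The dual functional for the marginals [g mu] and [nu].  The density [g] enters
the first term only, which is what makes the value affine in [g]. *)
Definition dual_value {R : realType} {n : nat} (mu nu : probability (sphere R n) R)
    (f g : sphere R n -> R) : R :=
  \int[mu]_x (f x * g x) + \int[nu]_y dual_potential f y.

Section duality.
Context {R : realType} {n : nat}.
Local Notation S := (sphere R n).
Context {mu nu : probability S R} {phi : S -> R} {B : R}.
Hypotheses (mphi : measurable_fun setT phi) (phiB : forall x, `|phi x| <= B).

Local Notation psi := (dual_potential phi).

Let c_transform_boundsB y : ((- B)%:E <= c_transform phi y <= B%:E)%E.
Proof.
rewrite -[X in (_ <= X%:E)%E]opprK; apply: c_transform_bounds => x.
by rewrite -ler_norml.
Qed.

Lemma dual_potentialE y : c_transform phi y = (psi y)%:E.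
Proof.
have /andP[l u] := c_transform_boundsB y.
rewrite fineK // fin_numE gt_eqF ?(lt_le_trans _ l) ?ltNyr //.
by rewrite lt_eqF // (le_lt_trans u) ?ltry.
Qed.

Lemma dual_potential_bounded y : `|psi y| <= B.
Proof. by rewrite ler_norml -!lee_fin -dual_potentialE. Qed.

Lemma measurable_dual_potential : measurable_fun setT psi.
Proof.
apply/measurable_EFinP; rewrite (_ : EFin \o psi = c_transform phi).
  exact: measurable_c_transform.
by apply/funext => y; rewrite dual_potentialE.
Qed.

Lemma dual_potential_le x y : ((phi x + psi y)%:E <= cost x y)%E.
Proof.
have := c_transform_le (phi := phi) x y.
by rewrite dual_potentialE leeBrDr // -EFinD addrC.
Qed.

Lemma dual_potential_integrable : nu.-integrable setT (EFin \o psi).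
Proof.
exact: bounded_integrable measurable_dual_potential dual_potential_bounded.
Qed.

Section with_density.
Context {rho : set S -> \bar R} {w : S -> R} {C : R}.
Hypotheses (mw : measurable_fun setT w) (wC : forall x, `|w x| <= C).
Hypothesis rho_density : has_density rho mu w.

Let integral_dual (ga : probability (S * S)%type R) : couplings rho nu ga ->
  (\int[ga]_z (phi z.1 + psi z.2)%:E)%E = (dual_value mu nu phi w)%:E.
Proof.
move=> cga.
have phiM x : `|phi x| <= Num.max B C by rewrite le_max phiB.
have psiM y : `|psi y| <= Num.max B C by rewrite le_max dual_potential_bounded.
have wM x : `|w x| <= Num.max B C by rewrite le_max wC orbT.
have iphiw : mu.-integrable setT (EFin \o (fun x => phi x * w x)).
  apply: (@bounded_integrable _ _ _ _ _ (B * C)); first exact: measurable_funM.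
  by move=> x; rewrite normrM ler_pM.
rewrite (coupling_integral mw wM mphi phiM measurable_dual_potential psiM
  rho_density cga).
by rewrite (EFin_Rintegral iphiw) (EFin_Rintegral dual_potential_integrable).
Qed.

(** The cost need not be integrable for a given coupling, but then its integral
is [+oo] and there is nothing to prove. *)
Lemma weak_duality : ((dual_value mu nu phi w)%:E <= K rho nu)%E.
Proof.
apply/ereal_infP => _ [ga cga <-]; rewrite -(integral_dual cga) /transport_value.
have psiM y : `|psi y| <= B by exact: dual_potential_bounded.
have iphipsi := coupling_integrable mphi phiB
  measurable_dual_potential psiM (ga := ga).
have [cfin|] := ltP (\int[ga]_z cost z.1 z.2)%E +oo%E; last first.
  by rewrite leye_eq => /eqP ->; exact: leey.
apply: le_integral => //.
  apply/integrableP; split; first exact: measurable_cost.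
  by under eq_integral do rewrite gee0_abs ?cost_ge0 //.
by move=> z _; exact: dual_potential_le.
Qed.

Lemma complementary_slackness (ga : probability (S * S)%type R) :
  couplings rho nu ga ->
  {ae ga, forall z, cost z.1 z.2 = ((phi z.1)%:E + c_transform phi z.2)%E} ->
  transport_value ga = (dual_value mu nu phi w)%:E.
Proof.
move=> cga slack; rewrite -(integral_dual cga); apply: ae_eq_integral => //.
- exact: measurable_cost.
- have psiM y : `|psi y| <= B by exact: dual_potential_bounded.
  exact: measurable_int (coupling_integrable mphi phiB
    measurable_dual_potential psiM (ga := ga)).
- by apply: filterS slack => z + _; rewrite dual_potentialE -EFinD.
Qed.

End with_density.
End duality.
(** * First variation *)

Lemma le_Rintegral_bound {d} {X : measurableType d} {R : realType}
    (m : probability X R) (f : X -> R) (C : R) :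
  measurable_fun setT f -> (forall x, `|f x| <= C) -> `|\int[m]_x f x| <= C.
Proof.
move=> mf fC; have fi := bounded_integrable m mf fC.
apply: (le_trans (le_normr_Rintegral _ fi)) => //.
have -> : C = \int[m]_x C.
  have m1 : fine (m setT) = 1 by exact: (congr1 fine (probability_setT m)).
  by rewrite Rintegral_cst // m1 mulr1.
apply: le_Rintegral => //.
- exact: integrable_norm.
- exact: (bounded_integrable _ (measurable_cst C) (fun=> lexx `|C|)).
Qed.

(** From [ln (1 + t) <= t] at [t = a / b - 1] and at [t = b / a - 1]. *)
Lemma ln_lipschitz {R : realType} (r a b : R) :
  0 < r -> r <= a -> r <= b -> `|ln a - ln b| <= r^-1 * `|a - b|.
Proof.
move=> r0 ra rb.
have half (s t : R) : r <= s -> r <= t -> ln s - ln t <= r^-1 * `|s - t|.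
  move=> rs rt; have s0 := lt_le_trans r0 rs; have t0 := lt_le_trans r0 rt.
  rewrite -ln_div ?posrE // -[s / t](subrK 1) addrC.
  apply: (le_trans (le_ln1Dx _)); first by rewrite ltrBrDr addNr divr_gt0.
  have -> : s / t - 1 = t^-1 * (s - t) by field; rewrite gt_eqF.
  rewrite (le_trans (ler_norm _)) // normrM gtr0_norm ?invr_gt0 //.
  by rewrite ler_wpM2r // lef_pV2 ?posrE.
by rewrite ler_norml lerNl opprB half // distrC half.
Qed.

Lemma log_support_bounded {R : realType} {n : nat} {Om : set 'rV[R]_n.+1}
    {h : sphere R n -> R} :
  convex_body Om -> is_support_function Om h ->
  exists B : R, forall x, `|- ln (h x)| <= B.
Proof.
move=> Omb hs; have [r r0 rh] := support_lower_bound Omb hs.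
have [M hM] := support_upper_bound Omb hs.
exists (Num.max (- ln r) (ln M)) => x; have h0 := lt_le_trans r0 (rh x).
rewrite normrN ler_norml lerNl !le_max lerN2.
by rewrite !ler_ln ?posrE ?rh ?hM ?orbT // (lt_le_trans h0).
Qed.

Lemma measurable_log_support {R : realType} {n : nat} {Om : set 'rV[R]_n.+1}
    {h : sphere R n -> R} :
  convex_body Om -> is_support_function Om h ->
  measurable_fun setT (fun x => - ln (h x)).
Proof.
move=> Omb hs; apply: measurableT_comp => //.
exact: (measurableT_comp (@measurable_ln R) (support_measurable Omb hs)).
Qed.

Section first_variation.
Context {R : realType} {n : nat}.
Local Notation S := (sphere R n).
Context {mu nu : probability S R}.

Lemma has_density1 : has_density mu mu (fun=> 1).
Proof. by move=> A mA; rewrite integral_cst // mul1e. Qed.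

(** A map gives no duality gap once its graph lies in the contact set.  The
hypothesis on [T] speaks of the cost of the map itself, so this is computed on
[mu] directly, without forming the coupling carried by the graph. *)
Lemma K_optimal_map {phi : S -> R} {B : R} {T : S -> S} :
  measurable_fun setT phi -> (forall x, `|phi x| <= B) -> optimal_map mu nu T ->
  (forall x, cost x (T x) = (phi x)%:E + c_transform phi (T x))%E ->
  K mu nu = (dual_value mu nu phi (fun=> 1))%:E.
Proof.
move=> mphi phiB [mT Tnu <-] contact.
have mpsi := measurable_dual_potential phiB.
have psiB := dual_potential_bounded phiB.
have iphi := bounded_integrable mu mphi phiB.
have ipsiT : mu.-integrable setT (EFin \o (dual_potential phi \o T)).
  apply: (@bounded_integrable _ _ _ _ _ B) => [|x]; last exact: psiB.
  exact: (measurableT_comp mpsi mT).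
under eq_integral do rewrite contact (dual_potentialE phiB).
rewrite integralD // EFinD; congr (_ + _)%E.
  by rewrite EFin_Rintegral //; under [in RHS]eq_Rintegral do rewrite mulr1.
rewrite -(EFin_Rintegral (dual_potential_integrable phiB)).
transitivity (\int[pushforward mu T]_y (dual_potential phi y)%:E)%E.
  by rewrite integral_pushforward //; exact/measurable_EFinP.
by apply: eq_measure_integral => A mA _; exact: Tnu.
Qed.

Lemma dual_value_perturb {phi v : S -> R} {B C : R} (eps : R) :
  measurable_fun setT phi -> (forall x, `|phi x| <= B) ->
  measurable_fun setT v -> (forall x, `|v x| <= C) ->
  dual_value mu nu phi (fun x => 1 + eps * v x) =
  dual_value mu nu phi (fun=> 1) + eps * \int[mu]_x (phi x * v x).
Proof.
move=> mphi phiB mv vC.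
have iphiv : mu.-integrable setT (EFin \o (fun x => phi x * v x)).
  apply: (@bounded_integrable _ _ _ _ _ (B * C)); first exact: measurable_funM.
  by move=> x; rewrite normrM ler_pM.
rewrite /dual_value addrAC; congr (_ + _); rewrite -RintegralZl // -RintegralD //.
- by apply: eq_Rintegral => x _; rewrite mulrDr mulrCA.
- under [X in integrable _ _ (_ \o X)]eq_fun do rewrite mulr1.
  exact: (bounded_integrable _ mphi phiB).
- have -> : EFin \o (fun x => eps * (phi x * v x)) =
    (fun x => eps%:E * (EFin \o (fun x => phi x * v x)%R) x)%E by [].
  exact: integrableZl.
Qed.

(** The sandwich.  Let [a] be the dual value of [phi] and [b] that of [phie], both
for the marginals [mu] and [nu], and let [I] and [Ie] be the integrals of [v]
against the two potentials.  Weak duality of [phie] for [mu] says [b <= a], weak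
duality of [phi] for the perturbed measure says [a + eps I <= b + eps Ie], and
the increment of [K] is [b + eps Ie - a]; it thus lies between [eps I] and
[eps Ie], whatever the sign of [eps]. *)
Lemma K_quotient_estimate {phi phie v : S -> R} {B Be C : R} {eps : R}
    {ga : probability (S * S)%type R} :
  measurable_fun setT phi -> (forall x, `|phi x| <= B) ->
  measurable_fun setT phie -> (forall x, `|phie x| <= Be) ->
  measurable_fun setT v -> (forall x, `|v x| <= C) ->
  eps != 0 ->
  K mu nu = (dual_value mu nu phi (fun=> 1))%:E ->
  couplings (perturb mu v eps) nu ga ->
  transport_value ga = K (perturb mu v eps) nu ->
  {ae ga, forall z, cost z.1 z.2 = (phie z.1)%:E + c_transform phie z.2}%E ->
  exists2 q : R,
    ((K (perturb mu v eps) nu - K mu nu) * (eps^-1)%:E = q%:E)%E &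
    `|q - \int[mu]_x (phi x * v x)| <=
      `|\int[mu]_x (phie x * v x) - \int[mu]_x (phi x * v x)|.
Proof.
move=> mphi phiB mphie phieB mv vC eps0 K0 cga tga slack.
have mw : measurable_fun setT (fun x => 1 + eps * v x).
  by apply: measurable_funD => //; apply: measurable_funM.
have wC x : `|1 + eps * v x| <= 1 + `|eps| * C.
  by rewrite (le_trans (ler_normD _ _)) // normr1 normrM lerD2l ler_wpM2l.
have dens : has_density (perturb mu v eps) mu (fun x => 1 + eps * v x) by [].
have one (x : S) : `|(1 : R)| <= 1 by rewrite normr1.
have := weak_duality (nu := nu) mphi phiB mw wC dens.
have := weak_duality (nu := nu) mphie phieB (measurable_cst (1 : R)) one has_density1.
have := complementary_slackness mphie phieB mw wC dens cga slack.
rewrite tga (dual_value_perturb eps mphi phiB mv vC).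
rewrite (dual_value_perturb eps mphie phieB mv vC) K0 => ->.
set a := dual_value mu nu phi _; set b := dual_value mu nu phie _.
set I := \int[mu]_x (phi x * v x); set Ie := \int[mu]_x (phie x * v x).
rewrite !lee_fin => ba aIb; exists ((b + eps * Ie - a) / eps) => //.
rewrite -(ler_pM2l (_ : 0 < `|eps|)) ?normr_gt0 // -!normrM.
rewrite mulrBr mulrCA mulfV // mulr1 mulrBr.
rewrite !ger0_norm; clear - ba aIb; lra.
Qed.

End first_variation.

Theorem lemma4p2 (R : realType) (n : nat)
  (sigma mu nu : probability (sphere R n) R)
  (V W : sphere R n -> R)
  (h : sphere R n -> R) (Om : set 'rV[R]_n.+1)
  (T : sphere R n -> sphere R n)
  (v u : sphere R n -> R) (h_ : R -> sphere R n -> R)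
  (sigma_unif : uniform_measure sigma)
  (mu_density : has_density mu sigma (fun x => expR (- V x)))
  (nu_density : has_density nu sigma (fun x => expR (- W x)))
  (mu_smooth : smooth (fun x => expR (- V x)))
  (nu_smooth : smooth (fun x => expR (- W x)))
  (Om_body : convex_body Om)
  (h_support : is_support_function Om h)
  (h_pos : forall x, 0 < h x)
  (h_smooth : smooth h)
  (h_D2 : D2_pos h)
  (T_smooth : forall i, smooth (fun x => pt (T x) ord0 i))
  (T_formula : forall x, pt (T x) =
     (Num.sqrt (h x ^+ 2 + enorm (sgrad h x) ^+ 2))^-1
       *: (h x *: pt x + sgrad h x))
  (T_optimal : optimal_map mu nu T)
  (v_smooth : smooth v)
  (v_mean : (\int[mu]_x (v x)%:E = 0)%E)
  (h_potential : \forall eps \near 0^',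
     kantorovich_potential (perturb mu v eps) nu (h_ eps))
  (u_smooth : smooth u)
  (h_expansion : forall d : R, 0 < d -> \forall eps \near 0^',
     forall x, `|h_ eps x - (h x + eps * u x)| <= d * `|eps|) :
  ((K (perturb mu v eps) nu - K mu nu) * (eps^-1)%:E)%E @[eps --> (0 : R)^']
    --> (- \int[mu]_x (ln (h x) * v x)%:E)%E.
Proof.
have [B lnhB] := log_support_bounded Om_body h_support.
have mlnh := measurable_log_support Om_body h_support.
have [Cv Cv0 vC] := smooth_bounded v_smooth.
have [Cu Cu0 uC] := smooth_bounded u_smooth.
have mv := continuous_sphere_measurable (smooth_continuous v_smooth).
have [r r0 rh] := support_lower_bound Om_body h_support.
have contact := cost_contact Om_body h_support h_pos (h_smooth [::]) T_formula.
have K0 := K_optimal_map mlnh lnhB T_optimal contact.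
have ilnhv : mu.-integrable setT (EFin \o (fun x => - ln (h x) * v x)).
  apply: (@bounded_integrable _ _ _ _ _ (B * Cv)); first exact: measurable_funM.
  by move=> x; rewrite normrM ler_pM.
set I := \int[mu]_x (- ln (h x) * v x).
have -> : (- (\int[mu]_x (ln (h x) * v x)%:E))%E = I%:E.
  have ipos : mu.-integrable setT (EFin \o (fun x => ln (h x) * v x)).
    apply: (@bounded_integrable _ _ _ _ _ (B * Cv)) => [|x].
      apply: measurable_funM => //; rewrite -[X in measurable_fun _ X]opprK.
      exact: measurableT_comp.
    by rewrite normrM ler_pM // -normrN.
  rewrite (EFin_Rintegral ipos) -EFinN -mulN1r -RintegralZl //; congr EFin.
  by apply: eq_Rintegral => x _; rewrite mulNr mul1r mulNr.
(* [1 + Cu] bounds [|h_eps - h| / |eps|], and [2 / r] is the Lipschitz constant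
   of [ln] on the range of [h] and of [h_eps] for small [eps]. *)
pose A := (r / 2)^-1 * (1 + Cu) * Cv.
pose Q eps := ((K (perturb mu v eps) nu - K mu nu) * (eps^-1)%:E)%E.
have A0 : 0 < A by rewrite !mulr_gt0 ?invr_gt0 ?divr_gt0 ?addr_gt0.
have near_est : \forall eps \near 0^',
    exists2 q : R, Q eps = q%:E & `|q - I| <= A * `|eps|.
  (* ensures [|h_eps - h| < r / 2], hence [h_eps >= r / 2] *)
  have small : \forall eps \near (0 : R)^', `|eps| < r / 2 / (1 + Cu).
    apply: dnbhs0_lt; rewrite !divr_gt0 ?addr_gt0 //.
  have ne0 : \forall eps \near (0 : R)^', eps != 0 by exact: nbhs_dnbhs_neq.
  near=> eps.
  have [[Ome Omeb hes] [ga [cga tga slack]]] :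
    kantorovich_potential (perturb mu v eps) nu (h_ eps).
    by near: eps.
  have hexp x : `|h_ eps x - (h x + eps * u x)| <= 1 * `|eps|.
    by move: x; near: eps; exact: h_expansion.
  have eps_small : `|eps| < r / 2 / (1 + Cu) by near: eps.
  have eps0 : eps != 0 by near: eps.
  have [Be lnheB] := log_support_bounded Omeb hes.
  have mlnhe := measurable_log_support Omeb hes.
  have [q Qq qI] := K_quotient_estimate mlnh lnhB mlnhe lnheB mv vC eps0 K0
    cga tga slack.
  exists q => //; apply: (le_trans qI).
  have ilnhev : mu.-integrable setT (EFin \o (fun x => - ln (h_ eps x) * v x)).
    apply: (@bounded_integrable _ _ _ _ _ (Be * Cv)); first exact: measurable_funM.
    by move=> x; rewrite normrM ler_pM.
  rewrite -RintegralB //.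
  apply: le_Rintegral_bound.
    by apply: measurable_funB; apply: measurable_funM.
  move=> x.
  have dh : `|h_ eps x - h x| <= (1 + Cu) * `|eps|.
    have -> : h_ eps x - h x = (h_ eps x - (h x + eps * u x)) + eps * u x by ring.
    rewrite (le_trans (ler_normD _ _)) // mulrDl lerD // normrM mulrC.
    by rewrite ler_wpM2r.
  have eps_r : (1 + Cu) * `|eps| < r / 2.
    by rewrite mulrC -ltr_pdivlMr ?addr_gt0.
  have her : r / 2 <= h_ eps x.
    have := rh x; move: dh; rewrite ler_norml => /andP[]; lra.
  have hr : r / 2 <= h x by have := rh x; lra.
  have -> : - ln (h_ eps x) * v x - - ln (h x) * v x =
    (ln (h x) - ln (h_ eps x)) * v x by ring.
  rewrite normrM /A mulrAC ler_pM //.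
  rewrite (le_trans (ln_lipschitz _ hr her)) ?divr_gt0 //.
  by rewrite -mulrA ler_wpM2l ?invr_ge0 ?divr_ge0 ?(ltW r0) // distrC.
apply: (@cvg_trans _ ((EFin \o (fine \o Q)) @ (0 : R)^')).
  apply: near_eq_cvg; apply: filterS near_est => eps [q Qq _].
  by rewrite /= -/(Q eps) Qq.
apply: cvg_EFin; first by apply: filterE.
apply/cvgrPdist_le => e e0.
near=> eps.
have [q Qq qI] : exists2 q : R, Q eps = q%:E & `|q - I| <= A * `|eps| by near: eps.
rewrite /= Qq /= distrC (le_trans qI) // mulrC -ler_pdivlMr // ltW //.
near: eps; apply: dnbhs0_lt; rewrite divr_gt0 //.
Unshelve. all: by end_near. Qed.
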